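(* Let $R,Q,\lambda,\mu>0$. Two units in series, of respective parameters $(R,\lambda)$ (from $x$ to $m$) and $(Q,\mu)$ (from $m$ to $y$), can be replaced by a single unit from $x$ to $y$ of parameters $$\Bigl(R\,\frac{(\lambda+1)\mu}{\lambda\mu+1}+Q\,\frac{\mu+1}{\lambda\mu+1},\ \lambda\mu\Bigr).$$
   Context: A unit of parameters $(R,\lambda)$ from $x$ to $y$ ($R,\lambda>0$) consists of a resistor $R/2$, then a voltage amplifier multiplying the potential by $\lambda$ in the direction from $x$ to $y$, then another resistor $R/2$. With potentials $u_x,u_y$ at its ends, the current $i_{xy}=-i_{yx}$ through it from $x$ to $y$ is determined by $u_y=\bigl(u_x-i_{xy}\frac R2\bigr)\lambda-i_{xy}\frac R2$, i.e. $i_{xy}=\frac{2}{R(1+\lambda)}(\lambda u_x-u_y)$. In series means that the second end of the first unit and the first end of the second unit are joined at a vertex $m$ which has no other connection, so that the current through the first unit from $x$ to $m$ equals the current through the second unit from $m$ to $y$. ''Can be replaced by'' means that for all potentials $u_x,u_y\in\mathbb R$ at the outer ends, the resulting current from $x$ to $y$ is the same for the combination and for the single unit. *)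

(* Defs.v *)
From Stdlib Require Import Reals Lra.
Open Scope R_scope.

(* A two-terminal network from [x] to [y] is given by the set of admissible
   triples (u_x, u_y, i): end potentials and current from [x] to [y]. *)
Definition network : Type := R -> R -> R -> Prop.

(* Resistor [r / 2], amplifier [lam] (acting from [x] to [y]), resistor [r / 2]. *)
Definition unit_network (r lam : R) : network :=
  fun ux uy i => uy = (ux - i * (r / 2)) * lam - i * (r / 2).

Lemma unit_networkE (r lam ux uy i : R) :
  0 < r -> 0 < lam ->
  unit_network r lam ux uy i <-> i = 2 / (r * (1 + lam)) * (lam * ux - uy).
Proof.
  intros Hr Hlam; unfold unit_network; split; intros H.
  - rewrite H; field; lra.
  - rewrite H; field; lra.
Qed.

(* The potential [um] of the middle vertex is free; as that vertex has no other
   connection, both parts carry the same current. *)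
Definition series (N1 N2 : network) : network :=
  fun ux uy i => exists um : R, N1 ux um i /\ N2 um uy i.

(* [unique P i] says that [P i] holds and [i] is the only such value: each
   network determines its current, and the two currents coincide. *)
Definition can_be_replaced_by (N N' : network) : Prop :=
  forall ux uy : R, exists i : R, unique (N ux uy) i /\ unique (N' ux uy) i.

(* Main.v *)
Require Import Defs.
From Stdlib Require Import Reals Lra.
Open Scope R_scope.

(** A unit [(r, lam)] imposes the single affine relation
    [uy = lam * ux - i * (r * (1 + lam) / 2)]: amplification by [lam] followed by
    a voltage drop across the output resistance [r * (1 + lam) / 2].  Composing
    two such affine maps of the potential at the same current [i] multiplies the
    slopes to [lam * mu], while the first drop is amplified by [mu] before the
    second one is added, for a total of
    [i * (r * (1 + lam) * mu + q * (1 + mu)) / 2].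
    The composite is therefore again a unit of amplification [lam * mu], whose
    resistance is found by dividing by [1 + lam * mu].  This gives an equality of
    relations ([series_unit_network]); since a unit with positive parameters
    determines its current ([unit_network_unique_current]), the two networks
    determine the same one. *)

Lemma unit_network_unique_current (r lam ux uy : R) :
  0 < r -> 0 < lam ->
  unique (unit_network r lam ux uy) (2 / (r * (1 + lam)) * (lam * ux - uy)).
Proof.
  intros Hr Hlam; split.
  - now apply unit_networkE.
  - intros i Hi; symmetry; now apply unit_networkE.
Qed.

(** The relation of the first unit expresses the middle potential in terms of
    [ux] and [i]; substituting it into the second eliminates that potential, and
    conversely this value of it is the witness. *)
Lemma series_unit_network (r q lam mu ux uy i : R) :
  lam * mu + 1 <> 0 ->
  series (unit_network r lam) (unit_network q mu) ux uy i <->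
  unit_network (r * (((lam + 1) * mu) / (lam * mu + 1))
                + q * ((mu + 1) / (lam * mu + 1))) (lam * mu) ux uy i.
Proof.
  intros Hd; unfold series, unit_network; split.
  - intros [um [-> ->]]; field; exact Hd.
  - intros ->; exists ((ux - i * (r / 2)) * lam - i * (r / 2)).
    split; [reflexivity | field; exact Hd].
Qed.

Theorem proposition4p1 (r q lam mu : R)
    (hr : 0 < r) (hq : 0 < q) (hlam : 0 < lam) (hmu : 0 < mu) :
  let r' := r * (((lam + 1) * mu) / (lam * mu + 1))
            + q * ((mu + 1) / (lam * mu + 1)) in
  let lam' := lam * mu in
  0 < r' /\ 0 < lam' /\
  can_be_replaced_by
    (series (unit_network r lam) (unit_network q mu))
    (unit_network r' lam').
Proof.
  intros r' lam'.
  assert (Hlam' : 0 < lam') by now apply Rmult_lt_0_compat.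
  assert (Hd : 0 < lam * mu + 1) by (unfold lam' in Hlam'; lra).
  assert (Hr' : 0 < r').
  { unfold r'; apply Rplus_lt_0_compat; apply Rmult_lt_0_compat; trivial;
      apply Rdiv_lt_0_compat; trivial; [apply Rmult_lt_0_compat |]; lra. }
  split; [exact Hr' | split; [exact Hlam' |]].
  intros ux uy; exists (2 / (r' * (1 + lam')) * (lam' * ux - uy)).
  pose proof (unit_network_unique_current r' lam' ux uy Hr' Hlam') as [Hi Huniq].
  split; [| now split].
  split.
  - apply series_unit_network; [lra | exact Hi].
  - intros i Hs; apply Huniq, series_unit_network; [lra | exact Hs].
Qed.
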